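(* Let $G$ be a finite $2$-group, and let $A$ be a finite $2$-group acting on $G$ by automorphisms. If $G$ is $d$-maximal for $A$-subgroups, then for all $n\geq 2$ the subgroup $\gamma_n(G)$ is almost powerfully embedded in $G$, and $\gamma_n(G)=P_n(G)=G^{2^{n-1}}$.
   Context: All groups are finite. For a finite $p$-group $G$, $d(G)$ denotes the minimal number of generators of $G$. If a group $A$ acts on $G$ (by automorphisms), an $A$-subgroup of $G$ is a subgroup of $G$ which is $A$-invariant. The group $G$ is called $d$-maximal for $A$-subgroups if $d(H)<d(G)$ for every proper $A$-subgroup $H$ of $G$. $(\gamma_n(G))_{n\geq 1}$ is the lower central series of $G$, with $\gamma_1(G)=G$ and $\gamma_{n+1}(G)=[\gamma_n(G),G]$. For a group $X$ and an integer $m\geq 1$, $X^{m}$ denotes the subgroup $\langle x^{m}\mid x\in X\rangle$. For a $2$-group $G$, the lower $2$-central series is defined by $P_1(G)=G$ and $P_{n+1}(G)=[P_n(G),G]\,P_n(G)^{2}$ for $n\geq 1$. For a $2$-group $G$, a subgroup $N\leq G$ is called almost powerfully embedded in $G$ if (i) $[N,G]\leq N^{2}$ and (ii) $[N,N]\leq (N^{2})^{2}$. *)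

(* Defs.v *)
From mathcomp Require Import all_boot all_fingroup all_solvable.

Set Implicit Arguments.
Unset Strict Implicit.
Unset Printing Implicit Defensive.

Import GroupScope.

Section Powers.

Variable gT : finGroupType.
Implicit Types X N G : {set gT}.

Definition power_subgroup (m : nat) X : {set gT} := <<[set x ^+ m | x in X]>>.

(* P_n(G), indexed from 1 with the same junk value at 0 as the library's 'L_n(G).
   The product is the set-wise one; it is a group since P_n(G) is normal in G. *)
Definition lower_2_central (n : nat) G : {set gT} :=
  iter n.-1 (fun P => [~: P, G] * power_subgroup 2 P) G.

Definition almost_powerfully_embedded (N G : {group gT}) : Prop :=
  [/\ N \subset G,
      [~: N, G] \subset power_subgroup 2 N
    & [~: N, N] \subset power_subgroup 2 (power_subgroup 2 N)].

End Powers.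

(* d(G) is the library's generator rank 'm(G), not the rank 'r(G). *)
Definition d_maximal (aT gT : finGroupType) (A : {group aT}) (G : {group gT})
    (to : groupAction A G) : Prop :=
  forall H : {group gT},
    H \proper G -> [acts A, on H | to] -> 'm(H) < 'm(G).

(* Main.v *)
(* Let V = Phi(G), which equals G' because Omega_1(G/G') needs as many generators
   as G/G'.  The point is that [V, G] <= Phi(V).  After quotients, suppose V is
   elementary abelian and [V, G] has order 2, and put C = C_G(V), D = C_V(G).
   The commutator pairing of G/C with V/D gives |G : C| <= |V : D|, and squares of
   elements of C centralise G, so Phi(C) <= D and |C : Phi(C)| >= |G : V|.  Hence
   d(C) >= d(G), a contradiction.  The rest is commutator calculus: modulo
   gamma_(n+2), squaring and commutation with G commute with each other, whence
   gamma_(n+1) = Phi(gamma_n) for n >= 2. *)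

Require Import Defs.
From mathcomp Require Import all_boot all_fingroup all_solvable.
Import GroupScope.

Set Implicit Arguments.
Unset Strict Implicit.
Unset Printing Implicit Defensive.

(** * Frattini subgroups, generator ranks and squares *)

Section Frattini.

Variable gT : finGroupType.
Implicit Types G H K N X : {group gT}.

Lemma quotient_grank_Phi G N : N <| G -> N \subset 'Phi(G) -> 'm(G / N) = 'm(G).
Proof.
move=> nsNG sNPhi; have [sNG nNG] := andP nsNG.
apply/eqP; rewrite eqn_leq quotient_grank //=.
have [B defB <-] := grank_witness (G / N)%G.
have sBG: B \subset G / N by rewrite -defB subset_gen.
pose Y := [set repr (val y) | y in B].
have sYG: Y \subset G.
  apply/subsetP=> _ /imsetP[y By ->]; rewrite -(quotientGK nsNG).
  by rewrite mem_morphpre ?repr_coset_norm //= coset_reprK (subsetP sBG).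
have sBY: B \subset Y / N.
  apply/subsetP=> y By; rewrite -[y]coset_reprK.
  rewrite mem_morphim ?repr_coset_norm //.
  by apply/imsetP; exists y.
suffices <-: <<Y>> = G.
  by apply: leq_trans (grank_min _) _; apply: leq_imset_card.
have nNY := subset_trans sYG nNG.
apply: Phi_nongen; apply/eqP; rewrite eqEsubset join_subG Phi_sub sYG /=.
have: G / N \subset <<Y>> / N.
  by rewrite -defB gen_subG (subset_trans sBY) // quotientS ?subset_gen.
rewrite quotientSK // => /subset_trans-> //.
by rewrite mul_subG ?(subset_trans sNPhi) ?joing_subl // gen_subG joing_subr.
Qed.

Lemma indexg_Phi (p : nat) G : p.-group G -> #|G : 'Phi(G)| = (p ^ 'm(G))%N.
Proof.
move=> pG; rewrite -(quotient_grank_Phi (Phi_normal G) (subxx _)).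
have abG := Phi_quotient_abelem pG.
rewrite grank_abelian ?(abelem_abelian abG) // (rank_abelem abG).
by rewrite -(card_pgroup (abelem_pgroup abG)) card_quotient // gFnorm.
Qed.

Lemma Phi_Mho2 G : 2.-group G -> 'Phi(G) = 'Mho^1(G).
Proof.
move=> pG; apply/eqP; rewrite eqEsubset andbC {1}(Phi_joing pG) joing_subr.
apply: (Phi_min pG (gFnorm _ _)); apply/exponent2_abelem/exponentP.
move=> _ /morphimP[x Nx Gx ->]; rewrite -morphX //.
by apply: coset_id; rewrite (Mho_p_elt 1) ?(mem_p_elt pG).
Qed.

Lemma Phi2_subP G K : 2.-group G ->
  reflect {in G, forall x, x ^+ 2 \in K} ('Phi(G) \subset K).
Proof.
move=> pG; rewrite (Phi_Mho2 pG) (MhoE 1 pG) expn1 gen_subG.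
apply: (iffP subsetP) => [sGK x Gx | sGK _ /imsetP[x Gx ->]]; last exact: sGK.
by apply: sGK; apply: imset_f.
Qed.

Lemma nil_comm_sub_trivg G H : nilpotent G -> H <| G -> H \subset [~: H, G] ->
  H :=: 1.
Proof.
move=> nilG /andP[sHG nHG]; apply: contraTeq => ntH.
apply: proper_subn; apply: (nil_comm_properl nilG) => //.
by rewrite subsetI subxx.
Qed.

End Frattini.

(* Passing to the semidirect product of [G] and [A] turns [A]-invariant normal
   subgroups of [G] into normal subgroups of the ambient group [X]. *)
Definition normal_d_maximal (gT : finGroupType) (X G : {group gT}) :=
  forall H : {group gT}, H <| X -> H \proper G -> 'm(H) < 'm(G).

(** * Consequences of maximality of the generator rank for the Frattini subgroup *)

Section DMaximal.

(** The full preimage of a proper normal subgroup is again proper and normal, and needs at least as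
    many generators, while [G / N] has the rank of [G]. *)
Lemma quotient_normal_d_maximal (gT : finGroupType) (X G N : {group gT}) :
  G <| X -> N <| X -> N \subset 'Phi(G) -> normal_d_maximal X G ->
  normal_d_maximal (X / N) (G / N).
Proof.
move=> /andP[sGX nGX] nsNX sNPhi dmaxG K nsKX ltKG; have [sNX nNX] := andP nsNX.
have sNG := subset_trans sNPhi (Phi_sub G).
have nsNG: N <| G by apply: normalS nsNX.
rewrite (quotient_grank_Phi nsNG sNPhi).
have nsHX: coset N @*^-1 K <| X by rewrite -(quotientGK nsNX) cosetpre_normal.
have ltHG: coset N @*^-1 K \proper G by rewrite -(quotientGK nsNG) cosetpre_proper.
apply: leq_ltn_trans (dmaxG _ nsHX ltHG).
by rewrite -{1}(cosetpreK K) quotient_grank ?subsetIl.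
Qed.

(** ['Ohm_1(G)] is characteristic and needs as many generators as the abelian group [G], so it
    cannot be proper. *)
Lemma d_maximal_abelian (gT : finGroupType) (X G : {group gT}) :
  2.-group G -> G <| X -> abelian G -> normal_d_maximal X G -> 'Phi(G) = 1.
Proof.
move=> pG nsGX cGG dmaxG; apply/eqP; rewrite (trivg_Phi pG).
have pO := pgroupS (Ohm_sub 1 G) pG.
suffices <-: 'Ohm_1(G) = G by rewrite Ohm1_abelem.
apply/eqP; rewrite eqEproper Ohm_sub; apply/negP=> ltOG.
have := dmaxG _ (gFnormal_trans _ nsGX) ltOG.
rewrite !grank_abelian ?(abelianS (Ohm_sub 1 G)) //.
by rewrite (rank_pgroup pG) (rank_pgroup pO) p_rank_Ohm1 ltnn.
Qed.

Lemma d_maximal_Phi_der (gT : finGroupType) (X G : {group gT}) :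
  2.-group G -> G <| X -> normal_d_maximal X G -> 'Phi(G) \subset G^`(1).
Proof.
move=> pG nsGX dmaxG.
have sG'Phi: G^`(1) \subset 'Phi(G) by rewrite (Phi_joing pG) joing_subl.
have nsG'X: G^`(1) <| X := gFnormal_trans _ nsGX.
have dmaxG1 := quotient_normal_d_maximal nsGX nsG'X sG'Phi dmaxG.
have := d_maximal_abelian (quotient_pgroup _ pG) (quotient_normal _ nsGX)
          (der_abelian 0 G) dmaxG1.
rewrite -(quotient_Phi pG) ?gFnorm // => /eqP; rewrite -subG1 quotient_sub1 //.
exact: subset_trans (Phi_sub G) (gFnorm _ _).
Qed.

(** Induction on the order of [W]: enlarge a maximal subgroup [U] by one element [w]. The index of
    ['C_G(W)] in ['C_G(U)] counts conjugates of [w], all in the coset of [[~: V, G]] by [w], so it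
    is at most 2, whereas [#|W : U|] is at least 2. *)
Lemma index_cent_comm_le2 (gT : finGroupType) (G V : {group gT}) :
    V \subset G -> #|[~: V, G]| <= 2 ->
  forall W : {group gT}, 'C_V(G) \subset W -> W \subset V ->
  #|G : 'C_G(W)| <= #|W : 'C_V(G)|.
Proof.
move=> sVG leZ W; move: {2}_.+1 (ltnSn #|W|) => m.
elim: m => // m IHm in W * => ltWm sDW sWV.
have [defW | ltDW] := eqVproper sDW.
  rewrite -defW indexgg; suffices ->: 'C_G('C_V(G)) = G by rewrite indexgg.
  by apply/setIidPl; rewrite centsC subsetIr.
have [U maxU sDU] : exists2 U : {group gT}, maximal U W & 'C_V(G) \subset U.
  have [eqDW | //] := maximal_exists sDW.
  by rewrite /= eqDW properxx in ltDW.
have [ltUW maxUW] := maxgroupP maxU; have sUW := proper_sub ltUW.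
have [_ [w Ww notUw]] := properP ltUW.
have defW: U <*> <[w]> = W.
  apply/eqP; rewrite eqEproper join_subG sUW cycle_subG Ww.
  apply: contra notUw => ltUwW; rewrite -cycle_subG.
  by rewrite -(maxUW _ ltUwW) ?joing_subl ?joing_subr.
have ltUm: #|U| < m by apply: leq_trans (proper_card ltUW) _.
have leU := IHm U ltUm sDU (subset_trans sUW sWV).
rewrite -(Lagrange_index sUW sDU) mulnC.
have ->: 'C_G(W) = 'C_('C_G(U))[w] by rewrite -defW centY cent_cycle setIA.
rewrite -(Lagrange_index (subsetIl G 'C(U)) (subsetIl _ _)) leq_mul //.
apply: (@leq_trans 2); last by rewrite indexg_gt1 proper_subn.
rewrite index_cent1 (leq_trans _ leZ) // -(card_lcoset [~: V, G] w) subset_leq_card //.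
apply/subsetP=> x /imsetP[g Cg ->]; have [Gg _] := setIP Cg.
by rewrite mem_lcoset -commgEl mem_commg ?(subsetP sWV).
Qed.

Lemma d_maximal_comm_Phi_neq2 (gT : finGroupType) (X G : {group gT}) :
    2.-group G -> G <| X -> normal_d_maximal X G -> 2.-abelem 'Phi(G) ->
  #|[~: 'Phi(G), G]| != 2.
Proof.
move=> pG nsGX dmaxG abV; apply/eqP=> oZ.
pose V := ('Phi(G))%G; pose C := ('C_G(V))%G; pose D := ('C_V(G))%G.
have cVV: abelian V := abelem_abelian abV.
have sVG: V \subset G := Phi_sub G.
have sG'V: G^`(1) \subset V by rewrite /= (Phi_joing pG) joing_subl.
have sVC: V \subset C by rewrite subsetI sVG.
have sCG: C \subset G := subsetIl _ _.
have nsCX: C <| X.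
  have nsVX: V <| X := gFnormal_trans _ nsGX.
  apply/andP; split; first exact: subset_trans sCG (normal_sub nsGX).
  exact: normsI (normal_norm nsGX) (norms_cent (normal_norm nsVX)).
have ltCG: C \proper G.
  rewrite properE sCG subsetI subxx /=; apply: contra_eqN oZ => cVG.
  by rewrite (commG1P _) ?cards1 // centsC.
have leC: #|G : C| <= #|V : D|.
  by apply: (index_cent_comm_le2 sVG) => //; rewrite ?oZ ?subsetIl.
have pC := pgroupS sCG pG.
have sPhiCD: 'Phi(C) \subset D.
  apply/(Phi2_subP _ pC)=> c Cc; have [Gc cVc] := setIP Cc.
  have Vc2: c ^+ 2 \in V by apply: (Phi2_subP V pG).
  rewrite inE Vc2; apply/centP=> g Gg; apply/commgP/conjg_fixP.
  have Vcg: [~ c, g] \in V by rewrite (subsetP sG'V) ?mem_commg.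
  (* [c ^ g] is [c * [~ c, g]]; the factors commute since [c] centralises [V], and the second
     squares to 1. *)
  rewrite conjXg conjg_mulR expgMn; last exact: (centP cVc).
  have [_ V2] := abelemP (isT : prime 2) abV.
  by rewrite (V2 _ Vcg) mulg1.
have := dmaxG _ nsCX ltCG; rewrite -(ltn_exp2l _ _ (isT : 1 < 2)).
rewrite -(indexg_Phi pC) -(indexg_Phi pG) ltnNge => /negP[].
(* [#|C : D|] is [#|C : V| * #|V : D|], hence by [leC] at least [#|C : V| * #|G : C|], which is
   [#|G : V|]. *)
apply: (@leq_trans #|C : D|); last by rewrite dvdn_leq ?indexg_gt0 ?indexgS.
rewrite -(Lagrange_index sCG sVC) -(Lagrange_index sVC (subsetIl _ _)) mulnC.
by rewrite leq_mul.
Qed.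

(** If the commutator were nontrivial, it would contain a subgroup [Q] of index 2 normal in the
    2-group [X], and [G / Q] would be the excluded case of order 2. *)
Lemma d_maximal_abelem_Phi_comm1 (gT : finGroupType) (X G : {group gT}) :
    2.-group X -> G <| X -> normal_d_maximal X G -> 2.-abelem 'Phi(G) ->
  [~: 'Phi(G), G] = 1.
Proof.
move=> pX nsGX dmaxG abPhi; have pG := pgroupS (normal_sub nsGX) pX.
have sZPhi: [~: 'Phi(G), G] \subset 'Phi(G) by rewrite commg_subl gFnorm.
have nsZX: [~: 'Phi(G), G] <| X.
  have nsPhiX: 'Phi(G) <| X := gFnormal_trans _ nsGX.
  apply/andP; split; last by rewrite normsR ?normal_norm.
  exact: subset_trans sZPhi (normal_sub nsPhiX).
have pZ := pgroupS (normal_sub nsZX) pX.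
apply/eqP/contraT=> ntZ; have [_ _ [m oZ]] := pgroup_pdiv pZ ntZ.
have leQ: m <= logn 2 #|[~: 'Phi(G), G]| by rewrite oZ pfactorK.
have [Q [sQZ nsQX oQ]] := normal_pgroup pX nsZX leQ.
have sQPhi := subset_trans sQZ sZPhi.
have sQG := subset_trans sQPhi (Phi_sub G).
have nQG := subset_trans (normal_sub nsGX) (normal_norm nsQX).
have nQPhi := subset_trans (Phi_sub G) nQG.
have defPhi: 'Phi(G / Q) = 'Phi(G) / Q by rewrite (quotient_Phi pG).
have := d_maximal_comm_Phi_neq2 (quotient_pgroup Q pG) (quotient_normal Q nsGX)
  (quotient_normal_d_maximal nsGX nsQX sQPhi dmaxG).
rewrite defPhi quotient_abelem // -quotientR //.
rewrite card_quotient ?(subset_trans sZPhi) //.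
by rewrite -divgS // oZ oQ expnS mulnK ?expn_gt0 // => /(_ isT).
Qed.

Lemma d_maximal_comm_Phi (gT : finGroupType) (X G : {group gT}) :
    2.-group X -> G <| X -> normal_d_maximal X G ->
  [~: 'Phi(G), G] \subset 'Phi('Phi(G)).
Proof.
move=> pX nsGX dmaxG; have pG := pgroupS (normal_sub nsGX) pX.
have pPhi := pgroupS (Phi_sub G) pG.
have nsKX: 'Phi('Phi(G)) <| X by rewrite !gFnormal_trans.
have nKG := subset_trans (normal_sub nsGX) (normal_norm nsKX).
have nKPhi := subset_trans (Phi_sub G) nKG.
have := d_maximal_abelem_Phi_comm1 (quotient_pgroup _ pX) (quotient_normal _ nsGX)
  (quotient_normal_d_maximal nsGX nsKX (Phi_sub _) dmaxG).
rewrite -(quotient_Phi pG) // Phi_quotient_abelem // => /(_ isT)/eqP.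
rewrite -quotientR // -subG1 quotient_sub1 //.
by apply: subset_trans nKPhi; rewrite commg_subl gFnorm.
Qed.

Lemma d_maximal_Phi (aT gT : finGroupType) (A : {group aT}) (G : {group gT})
    (to : groupAction A G) :
    2.-group G -> 2.-group A -> d_maximal to ->
  'Phi(G) \subset G^`(1) /\ [~: 'Phi(G), G] \subset 'Phi('Phi(G)).
Proof.
move=> pG pA dmaxG.
pose f := [morphism of sdpair1 to]; have injf: 'injm f := injm_sdpair1 to.
pose X : {group sdprod_by to} := [set: sdprod_by to]%G.
have pX: 2.-group X.
  by rewrite /= -(im_sdpair to) pgroupM !morphim_pgroup.
have nsGX: f @* G <| X.
  rewrite /normal subsetT /= -(im_sdpair to) mul_subG ?normG //.
  exact: im_sdpair_norm.
have dmaxX: normal_d_maximal X (f @* G).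
  move=> H /andP[_ nHX] ltHG.
  have defH: f @* (f @*^-1 H) = H by rewrite morphpreK ?proper_sub.
  rewrite -{1}defH !injm_grank ?subsetIl //; apply: dmaxG.
    by rewrite -(injm_proper injf) ?subsetIl // defH.
  (* Invariance under [A] means that the image in the semidirect product is normalised by the image
     of [A]. *)
  rewrite actsEsd ?subsetIl //; rewrite defH.
  exact: subset_trans (subsetT _) nHX.
have sub (H K : {set gT}) : H \subset G -> f @* H \subset f @* K -> H \subset K.
  by move=> sHG; rewrite injmSK.
split; apply: sub.
- exact: Phi_sub.
- rewrite injm_Phi // morphim_der //.
  exact: d_maximal_Phi_der (morphim_pgroup _ pG) nsGX dmaxX.
- by rewrite (subset_trans _ (Phi_sub G)) // commg_subl gFnorm.
rewrite morphimR ?Phi_sub // !injm_Phi ?(subset_trans (Phi_sub _)) ?Phi_sub //.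
exact: d_maximal_comm_Phi pX nsGX dmaxX.
Qed.

End DMaximal.

(** * Squares and commutators along the lower central series *)

Section LowerCentral.

Variable gT : finGroupType.
Implicit Types G H K N : {group gT}.

(** Modulo [N] the group [H] is abelian, so squaring is a homomorphism and it is enough to kill the
    squares of generators. *)
Lemma Phi_gen_sub H N (S : {set gT}) :
    2.-group H -> <<S>> = H -> H \subset 'N(N) -> [~: H, H] \subset N ->
  {in S, forall x, x ^+ 2 \in N} -> 'Phi(H) \subset N.
Proof.
move=> pH defH nNH sH'N sqS; apply: (Phi_min pH nNH).
have sSH: S \subset H by rewrite -defH subset_gen.
have abHN: abelian (H / N) by apply: quotient_cents2r.
apply: exponent2_abelem; rewrite /= -defH quotient_gen ?(subset_trans sSH) //.
rewrite abelian_exponent_gen ?(abelianS (quotientS N sSH)) //.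
apply/exponentP=> _ /morphimP[x Nx Sx ->].
by rewrite -morphX //; apply: coset_id; apply: sqS.
Qed.

(** With [c] for [[~ x, g]], the identity is [[~ x ^+ 2, g] = c ^+ 2 * [~ c, x] ^ c], whose last
    factor lies in [N]. *)
Lemma mem_commg_sqr G N x g : G \subset 'N(N) -> x \in G -> g \in G ->
  [~ x, g, x] \in N -> ([~ x ^+ 2, g] \in N) = ([~ x, g] ^+ 2 \in N).
Proof.
move=> /subsetP nNG Gx Gg Ncx; set c := [~ x, g] in Ncx *.
have ->: [~ x ^+ 2, g] = c ^+ 2 * [~ c, x] ^ c.
  by rewrite expgS expg1 commMgJ -/c conjg_mulR -mulgA (conjgC [~ c, x]) mulgA.
by rewrite groupMr // memJ_norm // nNG ?groupR.
Qed.

(** Three subgroups lemma modulo ['L_n.+3(G)], with ['L_2(G)] read as [[~: G, G]]. *)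
Lemma lcn_comm2 n G : [~: 'L_n.+1(G), 'L_2(G)] \subset 'L_n.+3(G).
Proof.
pose N := ('L_n.+3(G))%G; have nNG: G \subset 'N(N) := lcn_norm _ _.
have nNL m: 'L_m(G) \subset 'N(N) := subset_trans (lcn_sub _ _) nNG.
have LGG: [~: 'L_n.+1(G) / N, G / N, G / N] = 1.
  rewrite -quotientR // -lcnSn -quotientR // -lcnSn.
  exact: quotientS1.
have GLG: [~: G / N, 'L_n.+1(G) / N, G / N] = 1.
  by rewrite [[~: G / N, _]]commGC.
rewrite commGC -[_ \subset _]/(_ \subset gval N) -quotient_cents2 //.
apply/commG1P; rewrite lcn2 quotientR //; exact: three_subgroup GLG LGG.
Qed.

(** Modulo [K] the term lies in its own commutator with [G], so it vanishes by nilpotency.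
    Inclusions can thus be tested modulo the next term of the series. *)
Lemma lcn_sub_mod n G K : nilpotent G -> K <| G ->
  'L_n.+1(G) \subset K <*> 'L_n.+2(G) -> 'L_n.+1(G) \subset K.
Proof.
move=> nilG /andP[sKG nKG] sLK.
have nKL m: 'L_m(G) \subset 'N(K) := subset_trans (lcn_sub _ _) nKG.
rewrite -quotient_sub1 // subG1; apply/eqP.
apply: (nil_comm_sub_trivg (quotient_nil K nilG)).
  by rewrite quotient_normal ?lcn_normal.
by rewrite /= -quotientR ?nKL //= -lcnSn quotientSK -?norm_joinEr ?nKL.
Qed.

Variable G : {group gT}.
Hypotheses (pG : 2.-group G) (sPhiG' : 'Phi(G) \subset G^`(1)).

Let pL n : 2.-group 'L_n(G) := pgroupS (lcn_sub n G) pG.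

(** The next term is generated by commutators [[~ x, g]], whose squares agree with [[~ x ^+ 2, g]]
    one term further down; induction handles [x ^+ 2]. *)
Lemma Phi_lcn_sub n : 'Phi('L_n.+1(G)) \subset 'L_n.+2(G).
Proof.
elim: n => // n IHn.
apply: (Phi_gen_sub (S := commg_set 'L_n.+1(G) G) (pL n.+2)) => //.
- exact: subset_trans (lcn_sub _ _) (lcn_norm _ _).
- by rewrite commgS // lcn_sub.
move=> _ /imset2P[x g Lx Gg ->].
have Gx := subsetP (lcn_sub _ _) x Lx.
have mem_L3 y h: y \in 'L_n.+2(G) -> h \in G -> [~ y, h] \in 'L_n.+3(G).
  exact: mem_commg.
rewrite -(@mem_commg_sqr G) ?lcn_norm //; apply: mem_L3 => //.
  by rewrite (subsetP IHn) //; apply: (Phi2_subP _ (pL n.+1)).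
exact: mem_commg.
Qed.

Lemma Mho_lcn_sub n : 'Mho^n(G) \subset 'L_n.+1(G).
Proof.
rewrite (MhoE n pG) gen_subG; apply/subsetP=> _ /imsetP[x Gx ->].
elim: n => [|n IHn]; first by rewrite expg1.
rewrite expnSr expgM (subsetP (Phi_lcn_sub n)) //.
exact: (Phi2_subP _ (pL n.+1)).
Qed.

Hypothesis sPhiGPhi : [~: 'Phi(G), G] \subset 'Phi('Phi(G)).

Lemma lcn2_Phi : 'L_2(G) = 'Phi(G).
Proof.
by apply/eqP; rewrite eqEsubset sPhiG' andbT (Phi_joing pG) joing_subl.
Qed.

Lemma lcn_Phi n : 'L_n.+3(G) = 'Phi('L_n.+2(G)).
Proof.
apply/eqP; rewrite eqEsubset Phi_lcn_sub andbT.
elim: n => [|n IHn]; first by rewrite lcnSn lcn2_Phi.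
have{IHn} defL: 'L_n.+3(G) = 'Phi('L_n.+2(G)).
  by apply/eqP; rewrite eqEsubset IHn Phi_lcn_sub.
have nsKG: 'Phi('L_n.+3(G)) <| G by rewrite gFnormal_trans ?lcn_normal.
apply: (lcn_sub_mod (pgroup_nil pG) nsKG).
pose N := ('Phi('L_n.+3(G)) <*> 'L_(n.+4.+1)(G))%G.
have nNG: G \subset 'N(N) by rewrite normsY ?(normal_norm nsKG) ?lcn_norm.
have nNL m: 'L_m(G) \subset 'N(N) := subset_trans (lcn_sub _ _) nNG.
(* Centrality of ['L_n.+3(G)] modulo [N] is tested on the squares generating ['Phi('L_n.+2(G))]:
   [[~ x ^+ 2, g]] is traded for [[~ x, g] ^+ 2], with error in [[~: 'L_n.+3(G), 'L_2(G)]]. *)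
rewrite lcnSn -[_ <*> _]/(gval N) -quotient_cents2 // sub_quotient_pre //.
rewrite defL; apply/(Phi2_subP _ (pL n.+2))=> x Lx.
have Gx := subsetP (lcn_sub _ _) x Lx.
have Nx := subsetP nNG x Gx.
rewrite mem_morphpre ?groupX //=; apply/centP=> _ /morphimP[g Ng Gg ->].
apply/commgP; rewrite -morphR ?groupX //; apply/eqP/coset_id.
have Lxg: [~ x, g] \in 'L_n.+3(G) by rewrite lcnSn mem_commg.
rewrite (mem_commg_sqr nNG) //.
  by apply: (subsetP (joing_subl _ _)); apply: (Phi2_subP _ (pL n.+3)).
apply: (subsetP (joing_subr _ _)); apply: (subsetP (lcn_comm2 n.+2 G)).
by rewrite mem_commg // (subsetP (lcn_sub_leq _ _) x Lx).
Qed.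

(** By induction ['L_n.+2(G)] is generated by the powers [x ^+ (2 ^ n.+1)]. It is abelian modulo
    ['L_n.+4(G)], so its Frattini subgroup is controlled by the squares of these powers. *)
Lemma lcn_Mho n : 'L_n.+2(G) = 'Mho^n.+1(G).
Proof.
apply/eqP; rewrite eqEsubset Mho_lcn_sub andbT.
elim: n => [|n IHn]; first by rewrite lcn2_Phi Phi_Mho2.
apply: (lcn_sub_mod (pgroup_nil pG) (Mho_normal _ _)).
rewrite lcn_Phi.
apply: (Phi_gen_sub (S := [set x ^+ (2 ^ n.+1) | x in G]) (pL n.+2)).
- by rewrite -(MhoE _ pG); apply/eqP; rewrite eqEsubset IHn Mho_lcn_sub.
- by rewrite (subset_trans (lcn_sub _ _)) // normsY ?lcn_norm ?gFnorm.
- apply: subset_trans (joing_subr _ _); apply: subset_trans (lcn_comm2 n.+1 G).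
  by rewrite commgS ?lcn_sub_leq.
move=> _ /imsetP[x Gx ->]; rewrite -expgM -expnSr.
by rewrite (subsetP (joing_subl _ _)) // (Mho_p_elt n.+2) ?(mem_p_elt pG).
Qed.

Lemma lower_2_central_lcn n : lower_2_central n.+1 G = 'L_n.+1(G).
Proof.
elim: n => // n IHn; rewrite /lower_2_central /= -/(lower_2_central n.+1 G) IHn.
rewrite /power_subgroup -[2]/(2 ^ 1)%N -(MhoE 1 (pL n.+1)) -(Phi_Mho2 (pL n.+1)).
(* The factor of squares is absorbed by the commutator factor. *)
by rewrite mulGSid //; apply: Phi_lcn_sub.
Qed.

End LowerCentral.

Theorem corollary1p7 (aT gT : finGroupType) (A : {group aT}) (G : {group gT})
    (to : groupAction A G) (n : nat) :
  2.-group G -> 2.-group A -> d_maximal to -> 2 <= n ->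
  [/\ almost_powerfully_embedded 'L_n(G)%G G,
      'L_n(G) = lower_2_central n G
    & lower_2_central n G = power_subgroup (2 ^ n.-1) G].
Proof.
move=> pG pA dmaxG; case: n => [|[|n]] // _.
have [sPhiG' sPhiGPhi] := d_maximal_Phi pG pA dmaxG.
have pow2 (H : {group gT}) : H \subset G -> power_subgroup 2 H = 'Phi(H).
  by move=> sHG; rewrite Phi_Mho2 ?(MhoE 1 (pgroupS sHG pG)) ?(pgroupS sHG pG).
have sPhiLG: 'Phi('L_n.+2(G)) \subset G by rewrite gFsub_trans ?lcn_sub.
rewrite lower_2_central_lcn //; split=> //; last first.
  by rewrite lcn_Mho // (MhoE _ pG).
split; rewrite ?(pow2 _ (lcn_sub _ _)) ?(pow2 _ sPhiLG) ?lcn_sub //=.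
  by rewrite -lcn_Phi.
(* Two Frattini steps from ['L_n.+2(G)] reach ['L_n.+4(G)], which already contains
   [[~: 'L_n.+2(G), 'L_2(G)]]. *)
rewrite -!lcn_Phi //; apply: subset_trans (lcn_comm2 n.+1 G).
by rewrite commgS ?lcn_sub_leq.
Qed.
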